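(* Let $n$ be a positive integer. The power $x^n$ is well-defined in the free alternative groupoid $A$ generated by $x$ if and only if $n\le 5$.
   Context: A groupoid is a set with a binary operation. A groupoid is alternative if it satisfies the left alternative law $x(xy)=(xx)y$ and the right alternative law $x(yy)=(xy)y$ for all $x,y$ (the flexible law is not assumed). Let $G$ be the free groupoid on one generator $x$; its elements are the fully parenthesized words in the letter $x$, and the length of a word is its number of letters. The free alternative groupoid $A$ generated by $x$ consists of equivalence classes of words of $G$, two words being equivalent iff they can be obtained from each other by finitely many applications of the alternative laws (to subwords). For $n\ge1$, $x^n$ denotes any word of length $n$; $x^n$ is well-defined in $A$ if all words of length $n$ in $G$ represent the same element of $A$. *)

(* Defs.v *)
From HB Require Import structures.
From Stdlib Require Import Relations.
From mathcomp Require Import all_boot boolp.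

Set Implicit Arguments.
Unset Strict Implicit.
Unset Printing Implicit Defensive.

Import Algebra.

Local Open Scope quotient_scope.
Local Open Scope group_scope.

(* A groupoid (a set with one binary operation) is a [magmaType]. *)
Definition left_alternative (M : magmaType) : Prop :=
  forall x y : M, x * (x * y) = (x * x) * y.

Definition right_alternative (M : magmaType) : Prop :=
  forall x y : M, x * (y * y) = (x * y) * y.

Definition alternative (M : magmaType) : Prop :=
  left_alternative M /\ right_alternative M.

(* The free groupoid on one generator [Gen]. *)
Inductive word : Type :=
| Gen : word
| Mul : word -> word -> word.

Fixpoint wlength (w : word) : nat :=
  match w with
  | Gen => 1
  | Mul u v => (wlength u + wlength v)%N
  end.

Fixpoint word_encode (w : word) : GenTree.tree unit :=
  match w with
  | Gen => GenTree.Leaf tt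
  | Mul u v => GenTree.Node 0 [:: word_encode u; word_encode v]
  end.

Fixpoint word_decode (t : GenTree.tree unit) : option word :=
  match t with
  | GenTree.Leaf _ => Some Gen
  | GenTree.Node _ [:: t1; t2] =>
      match word_decode t1, word_decode t2 with
      | Some u, Some v => Some (Mul u v)
      | _, _ => None
      end
  | _ => None
  end.

Lemma word_encodeK : pcancel word_encode word_decode.
Proof. by elim=> [|u IHu v IHv] //=; rewrite IHu IHv. Qed.

HB.instance Definition _ := Countable.copy word (pcan_type word_encodeK).
HB.instance Definition _ := hasMul.Build word Mul.

(* One application of an alternative law, from left to right, to a subword.
   The direction from right to left comes from the symmetric closure below. *)
Inductive alt_step : word -> word -> Prop :=
| alt_step_left u v : alt_step (u * (u * v)) ((u * u) * v)
| alt_step_right u v : alt_step (u * (v * v)) ((u * v) * v)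
| alt_step_mull u u' v : alt_step u u' -> alt_step (u * v) (u' * v)
| alt_step_mulr u v v' : alt_step v v' -> alt_step (u * v) (u * v').

Definition alt_equiv : word -> word -> Prop := clos_refl_sym_trans word alt_step.

(* [generic_quotient] takes boolean relations. *)
Definition alt_equivb : rel word := fun u v => `[< alt_equiv u v >].

Lemma alt_equivb_refl : reflexive alt_equivb.
Proof. by move=> u; apply/asboolP; apply: rst_refl. Qed.

Lemma alt_equivb_sym : symmetric alt_equivb.
Proof. by move=> u v; apply/asboolP/asboolP; apply: rst_sym. Qed.

Lemma alt_equivb_trans : transitive alt_equivb.
Proof.
by move=> v u w /asboolP uv /asboolP vw; apply/asboolP; apply: rst_trans uv vw.
Qed.

Canonical alt_equiv_rel :=
  EquivRel alt_equivb alt_equivb_refl alt_equivb_sym alt_equivb_trans.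

(* The free alternative groupoid on one generator. *)
Definition free_alt : Type := {eq_quot alt_equivb}.

HB.instance Definition _ := Choice.on free_alt.
HB.instance Definition _ := EqQuotient.on free_alt.

Definition free_alt_mul : free_alt -> free_alt -> free_alt :=
  lift_op2 free_alt Mul.

HB.instance Definition _ := hasMul.Build free_alt free_alt_mul.

Definition free_alt_gen : free_alt := \pi_free_alt Gen.

Lemma pi_free_altP (u v : word) :
  \pi_free_alt u = \pi_free_alt v <-> alt_equiv u v.
Proof. by split=> [/eqmodP/asboolP | uv]; last by apply/eqmodP/asboolP. Qed.

Lemma alt_equivM (u u' v v' : word) :
  alt_equiv u u' -> alt_equiv v v' -> alt_equiv (u * v) (u' * v').
Proof.
move=> uu' vv'; apply: (@rst_trans _ _ _ (u' * v)).
  elim: uu' => [a b ab|a|a b _ IH|a b c _ IH1 _ IH2].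
  - by apply: rst_step; exact: alt_step_mull.
  - exact: rst_refl.
  - exact: rst_sym.
  - exact: rst_trans IH1 IH2.
elim: vv' => [a b ab|a|a b _ IH|a b c _ IH1 _ IH2].
- by apply: rst_step; exact: alt_step_mulr.
- exact: rst_refl.
- exact: rst_sym.
- exact: rst_trans IH1 IH2.
Qed.

Lemma pi_free_altM (u v : word) :
  \pi_free_alt (u * v) = \pi_free_alt u * \pi_free_alt v.
Proof.
rewrite [RHS]/mul /= /free_alt_mul -lock.
by apply/pi_free_altP/alt_equivM; apply/pi_free_altP; rewrite reprK.
Qed.

Lemma free_alt_alternative : alternative free_alt.
Proof.
split; elim/quotW=> u; elim/quotW=> v; rewrite -!pi_free_altM.
  by apply/pi_free_altP/rst_step; exact: alt_step_left.
by apply/pi_free_altP/rst_step; exact: alt_step_right.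
Qed.

Fixpoint word_eval (M : magmaType) (m : M) (w : word) : M :=
  match w with
  | Gen => m
  | Mul u v => word_eval m u * word_eval m v
  end.

Lemma word_eval_equiv (M : magmaType) (m : M) (u v : word) :
  alternative M -> alt_equiv u v -> word_eval m u = word_eval m v.
Proof.
move=> [la ra]; elim=> [a b|//|a b _ -> //|a b c _ -> _ -> //].
by elim=> {a b} [a b|a b|a a' b _|a b b' _] /= => [|| -> | ->].
Qed.

(* Universal property: [free_alt] is free among alternative groupoids. *)
Lemma free_alt_universal (M : magmaType) (m : M) : alternative M ->
  exists! f : free_alt -> M,
    f free_alt_gen = m /\ (forall a b : free_alt, f (a * b) = f a * f b).
Proof.
move=> altM; exists (fun a => word_eval m (repr a)).
have evP u : word_eval m (repr (\pi_free_alt u)) = word_eval m u.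
  by apply: word_eval_equiv => //; apply/pi_free_altP; rewrite reprK.
split=> [|g [g1 gM]].
  split=> [|]; first by rewrite evP.
  by elim/quotW=> a; elim/quotW=> b; rewrite -pi_free_altM !evP.
apply: funext; elim/quotW=> u; rewrite evP.
by elim: u => [|u IHu v IHv] /=; [rewrite -g1 | rewrite IHu IHv -gM -pi_free_altM].
Qed.

Definition power_well_defined (n : nat) : Prop :=
  forall u v : word, wlength u = n -> wlength v = n ->
    \pi_free_alt u = \pi_free_alt v.

(* Main.v *)
Require Import Defs.
From mathcomp Require Import all_boot.
From mathcomp Require Import zify.

(** Up to length 5, the two laws suffice to rewrite any product of two powers
    into the right-nested power of the same length ([rpowD]), so that in every
    alternative groupoid a word of length at most 5 evaluates to that power
    ([word_eval_rpow]).

    For longer words one needs, in each length [n >= 6], a set of words that is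
    closed under the alternative laws, contains a word of length [n], and
    contains no word [x * t]; the latter also exist in length [n], so the
    length does not determine the class ([separation]).

    In lengths 6 and 7 such a set is visible on the root of a word.  When a law
    is applied at the root of a word of length [n], the length [i] of the left
    factor is doubled modulo [n], in one direction or the other, and a law
    applied elsewhere does not change it.  So every set of residues that is
    saturated for doubling yields an invariant set of words
    ([split_in_invariant]): for [n = 6] the isolated residue 3, and for [n = 7]
    the quadratic nonresidues 3, 5, 6.

    This does not suffice in all lengths: modulo 8, for instance, every nonzero
    residue is linked to 4 by doubling.  Instead, an invariant set [P] without
    squares and without words [x * t] produces another one in the next length,
    namely the words [x * t] with [t] in [P]: since [t] is equivalent neither
    to a square nor to a product [x * s], no law ever applies at the root of
    [x * t].  This new set contains no word [t * x], so its mirror image has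
    all the properties required of [P] again ([rooted_separating]).  Starting
    from the nonresidues in length 7, all lengths [n >= 7] are reached. *)

Set Implicit Arguments.
Unset Strict Implicit.
Unset Printing Implicit Defensive.

Import Algebra.

Local Open Scope quotient_scope.
Local Open Scope group_scope.

Definition rpow (M : magmaType) (m : M) (n : nat) : M := iter n.-1 (mul m) m.

Lemma rpowD (M : magmaType) (m : M) (i j : nat) : alternative M ->
  (0 < i)%N -> (0 < j)%N -> (i + j <= 5)%N ->
  rpow m i * rpow m j = rpow m (i + j).
Proof.
move=> [la ra].
have r21 : rpow m 2 * m = rpow m 3 by rewrite /rpow /= -la.
have r22 : rpow m 2 * rpow m 2 = rpow m 4 by rewrite /rpow /= -la.
have r23 : rpow m 2 * rpow m 3 = rpow m 5 by rewrite /rpow /= -la.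
have r31 : rpow m 3 * m = rpow m 4 by rewrite -r21 -ra r22.
have r41 : rpow m 4 * m = rpow m 5 by rewrite -r22 -la r21 r23.
have r32 : rpow m 3 * rpow m 2 = rpow m 5 by rewrite [rpow m 2]/rpow /= ra r31 r41.
by case: i j => [|[|[|[|[|i]]]]] [|[|[|[|[|j]]]]] //=; rewrite ?addnS.
Qed.

Lemma wlength_gt0 (w : word) : (0 < wlength w)%N.
Proof. by elim: w => //= u IHu v IHv; lia. Qed.

Lemma word_eval_rpow (M : magmaType) (m : M) (w : word) :
  alternative M -> (wlength w <= 5)%N -> word_eval m w = rpow m (wlength w).
Proof.
move=> altM; elim: w => [|u IHu v IHv] //= le5.
have := wlength_gt0 u; have := wlength_gt0 v => v_gt0 u_gt0.
by rewrite IHu ?IHv ?rpowD //; lia.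
Qed.

Lemma pi_word_eval (w : word) : \pi_free_alt w = word_eval free_alt_gen w.
Proof. by elim: w => //= u <- v <-; rewrite -pi_free_altM. Qed.

Lemma power_well_defined_le5 (n : nat) : (n <= 5)%N -> power_well_defined n.
Proof.
move=> n_le5 u v uE vE; rewrite !pi_word_eval.
by rewrite !word_eval_rpow ?uE ?vE //; exact: free_alt_alternative.
Qed.

Definition invariant (P : pred word) : Prop :=
  forall a b : word, alt_step a b -> P a = P b.

Lemma invariant_equiv (P : pred word) (a b : word) :
  invariant P -> alt_equiv a b -> P a = P b.
Proof. by move=> invP; elim=> [u v /invP|//|u v _ ->|u v w _ -> _ ->]. Qed.

Lemma wlength_rcomb (n : nat) : wlength (iter n (Mul Gen) Gen) = n.+1.
Proof. by elim: n => //= n ->. Qed.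

(** A word [w] is separated from the right-nested word of its length, which is
    a product [x * t] as soon as the length is at least 2. *)
Lemma separation (P : pred word) (w : word) :
  invariant P -> (forall t, ~~ P (Gen * t)) -> P w -> (1 < wlength w)%N ->
  ~ power_well_defined (wlength w).
Proof.
move=> invP PGenF Pw w_gt1 wd.
have := wd w (iter (wlength w).-1 (Mul Gen) Gen) erefl.
rewrite wlength_rcomb prednK ?wlength_gt0 // => /(_ erefl)/pi_free_altP.
move=> /(invariant_equiv invP).
case: (wlength w) w_gt1 => [|[|k]] //= _.
by rewrite Pw => /esym; apply/negP/PGenF.
Qed.

Definition split_in (n : nat) (D : seq nat) : pred word := fun w =>
  if w is Mul u v then (wlength u + wlength v == n) && (wlength u \in D)
  else false.

Lemma alt_step_wlength (a b : word) : alt_step a b -> wlength a = wlength b.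
Proof. by elim=> //= [u v|u v|u u' v _ ->|u v v' _ ->] //; lia. Qed.

(** At the root, [u (u v) -> (u u) v] doubles [i = |u|] to [2 i < n], whereas
    [u (v v) -> (u v) v] replaces [|u|] by [j = |u| + |v|] with
    [2 j = n + |u|]. *)
Lemma split_in_invariant (n : nat) (D : seq nat) :
  (forall i, (0 < i < n)%N -> i.*2 != n -> (i.*2 %% n \in D) = (i \in D)) ->
  invariant (split_in n D).
Proof.
move=> D2 a b; case=> {a b} [u v|u v|u u' v /alt_step_wlength uu'
  |u v v' /alt_step_wlength vv'] /=; last 2 first.
- by rewrite uu'.
- by rewrite vv'.
- have [u_gt0 v_gt0] := (wlength_gt0 u, wlength_gt0 v).
  rewrite addnA; case: eqP => //= nE; rewrite -D2; [|lia|lia].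
  by rewrite modn_small ?addnn //; lia.
- have [u_gt0 v_gt0] := (wlength_gt0 u, wlength_gt0 v).
  rewrite addnA; case: eqP => //= nE.
  rewrite -(D2 (wlength u + wlength v)%N); [|lia|lia].
  have -> : ((wlength u + wlength v).*2 = wlength u + n)%N by lia.
  by rewrite modnDr modn_small //; lia.
Qed.

Fixpoint mirror (w : word) : word :=
  if w is Mul u v then Mul (mirror v) (mirror u) else Gen.

Lemma mirrorK : involutive mirror.
Proof. by elim=> //= u -> v ->. Qed.

Lemma wlength_mirror (w : word) : wlength (mirror w) = wlength w.
Proof. by elim: w => //= u -> v ->; rewrite addnC. Qed.

(** Reversal exchanges the two laws, and the two sides of each. *)
Lemma mirror_step (a b : word) :
  alt_step a b -> alt_step (mirror b) (mirror a).
Proof.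
elim=> {a b} [u v|u v|u u' v _ IH|u v v' _ IH] /=.
- exact: alt_step_right.
- exact: alt_step_left.
- exact: alt_step_mulr.
- exact: alt_step_mull.
Qed.

Record separating (P : pred word) : Prop := Separating {
  separating_invariant : invariant P;
  separating_gen : ~~ P Gen;
  separating_sqr u : ~~ P (u * u);
  separating_genM t : ~~ P (Gen * t) }.

(** The mirror image of the set of words [x * t] with [t] in [P]. *)
Definition rooted (P : pred word) : pred word := fun w =>
  if w is Mul u Gen then P (mirror u) else false.

(** For a word [u * x] with [mirror u] in [P], the conditions on squares and on
    words [x * t] say that no law applies at the root; a law applied inside a
    factor leaves the right factor [x] alone, as both of its sides are
    products. *)
Lemma rooted_separating (P : pred word) :
  separating P -> separating (rooted P).
Proof.
move=> [invP PGen Psqr PGenM]; split=> [a b|//|[|u v]|[|t1 t2]] //.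
case=> {a b} [u [|v1 v2]|u [|v1 v2]|u u' [|v1 v2] uu'|u v v' vv'] //=.
- by rewrite (negbTE (Psqr _)).
- by rewrite (negbTE (PGenM _)).
- by rewrite (invP _ _ (mirror_step uu')).
- by case: vv'.
Qed.

Lemma separating_exists (n : nat) : (7 <= n)%N ->
  exists2 P, separating P & exists2 w, P w & wlength w = n.
Proof.
move=> /subnK <-; elim: (n - 7)%N => [|k [P sepP [w Pw wE]]].
  exists (split_in 7 [:: 3; 5; 6]).
    split=> [|//|u|t]; last 1 first.
    - by rewrite /= inE /= andbF.
    - by apply: split_in_invariant; do 7 case=> //.
    - by rewrite /= addnn; case: eqP => //= /(congr1 odd); rewrite odd_double.
  by exists (iter 2 (Mul Gen) Gen * iter 3 (Mul Gen) Gen).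
exists (rooted P); first exact: rooted_separating.
exists (mirror w * Gen); first by rewrite /= mirrorK.
by rewrite /= wlength_mirror wE addn1.
Qed.

(** The set used here consists of products [u * v] with both factors of length
    3, hence contains squares: it cannot start the passage to greater lengths,
    and indeed [x * (u * u)] is equivalent to [(x * u) * u]. *)
Lemma power6_not_well_defined : ~ power_well_defined 6.
Proof.
pose w3 := iter 2 (Mul Gen) Gen.
apply: (@separation (split_in 6 [:: 3]) (w3 * w3)) => //.
  by apply: split_in_invariant; do 6 case=> //.
by move=> t; rewrite /= andbF.
Qed.

Theorem corollary3p7 (n : nat) (n_gt0 : (0 < n)%N) :
  power_well_defined n <-> (n <= 5)%N.
Proof.
split=> [|/power_well_defined_le5 //]; rewrite leqNgt => wd; apply/negP => n_gt5.
have [n6|n_ge7] : n = 6 \/ (7 <= n)%N by lia.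
  by apply: power6_not_well_defined; rewrite -n6.
have [P [invP _ _ PGenM] [w Pw wE]] := separating_exists n_ge7.
by apply: (separation invP PGenM Pw); rewrite wE // (leq_trans _ n_ge7).
Qed.
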